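(* Let $d$ be a positive integer and let $G$ be a group generated by $d$ elements. Then $G$ is chiral if and only if there is a word $w$ on $d$ variables such that $(G,w)$ is chiral.
   Context: A word $w$ on $k$ variables is an element of the free group on $x_1,\dots,x_k$. For a group $G$, $w$ induces by evaluation a map $w:G^{(k)}\to G$, where $G^{(k)}$ is the direct product of $k$ copies of $G$; its image is denoted $G_w$ (not assumed closed under inverses). A pair $(G,w)$ is chiral if $G_w\neq G_{w^{-1}}$, equivalently if the set of inverses of elements of $G_w$ is not equal to $G_w$. A group $G$ is chiral if $(G,w)$ is chiral for some word $w$ in some finite number of variables. *)

(* Defs.v *)
From HB Require Import structures.
From mathcomp Require Import all_boot.
From mathcomp Require Import boolp classical_sets.

Set Implicit Arguments.
Unset Strict Implicit.
Unset Printing Implicit Defensive.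

Local Open Scope classical_set_scope.
Local Open Scope group_scope.

(* The free group on X, as the type of reduced words.  The letter (x, false)  *)
(* stands for x and (x, true) for x^-1.                                       *)

Section Letters.
Variable X : choiceType.
Implicit Types (x y : X * bool) (s t u v : seq (X * bool)).

Definition letterV x : X * bool := (x.1, ~~ x.2).

Definition reduced s : bool := sorted (fun x y => y != letterV x) s.

Definition push x s :=
  if s is y :: s' then if y == letterV x then s' else x :: s else [:: x].

(* The reduced form of s ++ t, for reduced t. *)
Definition reduced_cat s t := foldr push t s.

Definition wordV s := rev (map letterV s).

Lemma letterVK : involutive letterV.
Proof. by move=> [x b]; rewrite /letterV /= negbK. Qed.

Lemma letterV_neq x : (x == letterV x) = false.
Proof. by case: x => x b; rewrite /letterV xpair_eqE /= andbC; case: b. Qed.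

Lemma push_reduced x s : reduced s -> reduced (push x s).
Proof.
case: s => [|y s] //= red_s; case: eqP => [_|/eqP neq_yx] /=.
  exact: path_sorted red_s.
by rewrite neq_yx.
Qed.

Lemma pushVK x s : reduced s -> push (letterV x) (push x s) = s.
Proof.
case: s => [|y s] /= red_s; first by rewrite letterVK eqxx.
case: eqP => [def_y | _] /=; last by rewrite letterVK eqxx.
case: s red_s => [|z s] /=; first by rewrite def_y.
by rewrite def_y letterVK => /andP[/negPf-> _].
Qed.

Lemma reduced_cat_reduced s t : reduced t -> reduced (reduced_cat s t).
Proof. by move=> red_t; elim: s => //= x s; apply: push_reduced. Qed.

Lemma reduced_cats0 s : reduced s -> reduced_cat s [::] = s.
Proof.
elim: s => //= x s IHs red_s.
rewrite IHs; last exact: path_sorted red_s.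
by case: s red_s {IHs} => //= y s /andP[/negPf-> _].
Qed.

Lemma reduced_cat_push x s t :
  reduced t -> reduced_cat (push x s) t = push x (reduced_cat s t).
Proof.
case: s => [|y s] //= red_t; case: eqP => //= ->.
by rewrite -{1}(letterVK x) pushVK ?reduced_cat_reduced.
Qed.

Lemma reduced_catA s t u :
  reduced u -> reduced_cat s (reduced_cat t u) =
               reduced_cat (reduced_cat s t) u.
Proof. by move=> red_u; elim: s => //= x s ->; rewrite reduced_cat_push. Qed.

Lemma wordVK : involutive wordV.
Proof. by move=> s; rewrite /wordV map_rev revK (mapK letterVK). Qed.

Lemma wordV_reduced s : reduced s -> reduced (wordV s).
Proof.
rewrite /reduced /wordV rev_sorted sorted_map; apply: sub_sorted => x y /=.
by rewrite letterVK eq_sym.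
Qed.

Lemma reduced_catVs s : reduced s -> reduced_cat (wordV s) s = [::].
Proof.
move=> red_s; rewrite -{2}(reduced_cats0 red_s).
have: reduced [::] by []; move: [::] => t.
elim: s t {red_s} => //= x s IHs t red_t.
rewrite /reduced_cat /wordV /= rev_cons foldr_rcons pushVK; first exact: IHs.
exact: reduced_cat_reduced.
Qed.

Lemma reduced_catsV s : reduced s -> reduced_cat s (wordV s) = [::].
Proof.
by move=> red_s; rewrite -{1}(wordVK s) reduced_catVs ?wordV_reduced.
Qed.

End Letters.

Record free_group (X : choiceType) : Type :=
  FreeGroup {free_word :> seq (X * bool); _ : reduced free_word}.

HB.instance Definition _ (X : choiceType) := [isSub for @free_word X].
HB.instance Definition _ (X : choiceType) := [Choice of free_group X by <:].

Section FreeGroupOps.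
Variable X : choiceType.
Implicit Types u v : free_group X.

Definition free_one : free_group X := @FreeGroup X [::] isT.
Definition free_inv u : free_group X := FreeGroup (wordV_reduced (valP u)).
Definition free_mul u v : free_group X :=
  FreeGroup (reduced_cat_reduced u (valP v)).

Lemma free_mulA : associative free_mul.
Proof. by move=> u v w; apply/val_inj/reduced_catA/valP. Qed.
Lemma free_mul1g : left_id free_one free_mul.
Proof. by move=> u; apply/val_inj. Qed.
Lemma free_mulg1 : right_id free_one free_mul.
Proof. by move=> u; apply/val_inj/reduced_cats0/valP. Qed.
Lemma free_mulVg : left_inverse free_one free_inv free_mul.
Proof. by move=> u; apply/val_inj/reduced_catVs/valP. Qed.
Lemma free_mulgV : right_inverse free_one free_inv free_mul.
Proof. by move=> u; apply/val_inj/reduced_catsV/valP. Qed.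

End FreeGroupOps.

HB.instance Definition _ (X : choiceType) :=
  isGroup.Build (free_group X) (@free_mulA X) (@free_mul1g X) (@free_mulg1 X)
    (@free_mulVg X) (@free_mulgV X).

Definition free_gen (X : choiceType) (x : X) : free_group X :=
  @FreeGroup X [:: (x, false)] isT.

Definition word (k : nat) := free_group 'I_k.

Definition letter_eval (G : groupType) (X : choiceType) (g : X -> G)
  (x : X * bool) : G := if x.2 then (g x.1)^-1 else g x.1.

Definition word_map (G : groupType) (k : nat) (w : word k)
  (g : {ffun 'I_k -> G}) : G := \prod_(x <- free_word w) letter_eval g x.

(* The next three lemmas say that w |-> word_map w g is the homomorphism from *)
(* the free group to G sending the i-th generator to g i.                     *)

Lemma word_map_gen (G : groupType) (k : nat) (g : {ffun 'I_k -> G}) i :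
  word_map (free_gen i) g = g i.
Proof. by rewrite /word_map big_seq1. Qed.

Lemma word_mapM (G : groupType) (k : nat) (g : {ffun 'I_k -> G}) :
  {morph (fun w : word k => word_map w g) : u v / u * v}.
Proof.
move=> u v; rewrite /word_map /=.
elim: (free_word u) => [|x s IHs] /=; first by rewrite big_nil mul1g.
rewrite big_cons -mulgA -IHs; case: (reduced_cat s v) => [|y t] /=.
  by rewrite big_seq1 big_nil mulg1.
case: eqP => [->|_]; rewrite !big_cons // mulgA /letter_eval /=.
by case: x.2; rewrite /= ?mulgV ?mulVg mul1g.
Qed.

Lemma word_mapV (G : groupType) (k : nat) (g : {ffun 'I_k -> G}) :
  {morph (fun w : word k => word_map w g) : u / u^-1}.
Proof.
move=> u; apply: (mulgI (word_map u g)).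
by rewrite -word_mapM !mulgV /word_map big_nil.
Qed.

Definition word_image (G : groupType) (k : nat) (w : word k) : set G :=
  range (@word_map G k w).

Arguments word_image G [k] w _.

Definition chiral_pair (G : groupType) (k : nat) (w : word k) : Prop :=
  word_image G w <> word_image G w^-1.

Definition chiral (G : groupType) : Prop :=
  exists (k : nat) (w : word k), chiral_pair G w.

Definition subgroup (G : groupType) (H : set G) : Prop := group_closed [in H].

Definition generated (G : groupType) (S : set G) : set G :=
  smallest (@subgroup G) S.

(* The d generators may repeat, so this is "generated by at most d elements"  *)
(* when d > 0.                                                                *)
Definition generated_by (G : groupType) (d : nat) : Prop :=
  exists g : 'I_d -> G, generated (range g) = setT.

(* Main.v *)
Require Import Defs.
From mathcomp Require Import all_boot.
From mathcomp Require Import boolp classical_sets.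

(** Only the direction from [k] variables to [d] variables has content.  The
    set of values of [w^-1] consists of the inverses of the values of [w], so
    chirality of [w] means that some value [w(h)] has an inverse which is not a
    value of [w] ([chiral_pairP]).  If [g] is a generating [d]-tuple, each
    [h_i] is [u_i(g)] for a word [u_i] on [d] variables ([generated_word_map]).
    The composite word [w' = w(u_1, ..., u_k)] on [d] variables then takes the
    value [w(h)] at [g], while every value of [w'] is also a value of [w]
    ([word_map_subst]); hence the inverse of [w(h)] is not a value of [w'], and
    [w'] is chiral. *)

Local Open Scope classical_set_scope.
Local Open Scope group_scope.

Lemma word_map1 (G : groupType) (k : nat) (g : {ffun 'I_k -> G}) :
  word_map 1 g = 1.
Proof. by rewrite /word_map big_nil. Qed.

Lemma word_imageV (G : groupType) (k : nat) (w : word k) (x : G) :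
  word_image G w^-1 x <-> word_image G w x^-1.
Proof.
split=> -[g _ def_x]; exists g => //; first by rewrite -def_x word_mapV invgK.
by rewrite word_mapV def_x invgK.
Qed.

(** If the values of [w] are closed under inversion then so are those of
    [w^-1], being their inverses; thus a failure of either inclusion between
    the two images provides the same kind of witness. *)
Lemma chiral_pairP (G : groupType) (k : nat) (w : word k) :
  chiral_pair G w <->
  exists g : {ffun 'I_k -> G}, ~ word_image G w (word_map w g)^-1.
Proof.
split=> [chi_w | [g not_wVg] eq_w].
  apply: contrapT => /forallNP closed_w; apply: chi_w.
  have wV x : word_image G w x -> word_image G w x^-1.
    by case=> g _ <-; apply: contrapT (closed_w g).
  apply/seteqP; split=> x; rewrite word_imageV; first exact: wV.
  by move/wV; rewrite invgK.
apply: not_wVg; apply/word_imageV; rewrite -eq_w.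
by exists g.
Qed.

(** Since free groups are groups, [word_map w u], for a tuple [u] of words, is
    the word obtained by substituting [u] in [w]. *)
Lemma word_map_subst (G : groupType) (k d : nat) (w : word k)
    (u : {ffun 'I_k -> word d}) (g : {ffun 'I_d -> G}) :
  word_map (word_map w u) g = word_map w [ffun i => word_map (u i) g].
Proof.
rewrite [word_map w u]/word_map.
rewrite (big_morph _ (word_mapM g) (word_map1 _ _ g)).
apply: eq_bigr => -[i b] _; rewrite /letter_eval /= ffunE.
by case: b => //; rewrite word_mapV.
Qed.

(** The values at [g] of all the words form a subgroup containing the entries
    of [g], because evaluation at [g] is a homomorphism. *)
Lemma generated_word_map (G : groupType) (d : nat) (g : {ffun 'I_d -> G}) :
  generated (range g) `<=` range (fun u : word d => word_map u g).
Proof.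
apply: smallest_sub => [|_ [i _ <-]]; last first.
  by exists (free_gen i) => //; rewrite word_map_gen.
split=> [|x y]; first by apply/mem_set; exists 1 => //; rewrite word_map1.
move=> /set_mem[u _ <-] /set_mem[v _ <-]; apply/mem_set.
by exists (u * v^-1) => //; rewrite word_mapM word_mapV.
Qed.

Theorem theorem2 (d : nat) (G : groupType) :
  (0 < d)%N -> generated_by G d ->
  (chiral G <-> exists w : word d, chiral_pair G w).
Proof.
move=> _ [g0 gen_g0]; split=> [[k [w /chiral_pairP[h not_wVh]]] | [w chi_w]];
  last by exists d, w.
pose g := [ffun i => g0 i].
have g_words x : exists u : word d, word_map u g = x.
  have [|u _ def_x] := generated_word_map G d g x; last by exists u.
  suff -> : (g : 'I_d -> G) = g0 by rewrite gen_g0.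
  by apply/funext => i; rewrite ffunE.
have /choice[u def_h] := fun i => g_words (h i).
exists (word_map w [ffun i => u i]); apply/chiral_pairP; exists g.
have -> : word_map (word_map w [ffun i => u i]) g = word_map w h.
  rewrite word_map_subst; congr (word_map w _).
  by apply/ffunP => i; rewrite !ffunE def_h.
case=> y _; rewrite word_map_subst => val_y; apply: not_wVh.
by rewrite -val_y; exists [ffun i => word_map ([ffun i => u i] i) y].
Qed.
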